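(* Let $X$ be a metric space with a measure $\mu$ such that every nonempty open set has positive $\mu$-measure, and let $(T_t)_{t\in\mathbb{R}}$ be a $\mu$-preserving flow on $X$ that is ergodic with respect to $\mu$. Let $f:X\to\mathbb{R}$ be a $\mu$-integrable function with zero mean, $\int_X f\,d\mu=0$, and suppose that for $\mu$-almost all $x$ the integrals $\sigma(t,x)=\int_0^t f(T_sx)\,ds$ make sense for all $t$ and are continuous in $t$. Then for $\mu$-almost all $x$ with $f(x)\neq 0$ there is a sequence $t_k\to\infty$ such that $\sigma(t_k,x)=0$ for all $k$ and $T_{t_k}x\to x$ as $k\to\infty$.
   Context: The measure $\mu$ is a probability measure defined on (a $\sigma$-algebra containing) the Borel sets of the metric space $X$. A flow is a measurable one-parameter group $(T_t)_{t\in\mathbb{R}}$ of invertible $\mu$-preserving transformations of $X$ (with $(t,x)\mapsto T_tx$ measurable). It is ergodic if every measurable set invariant under all $T_t$ has measure $0$ or $1$. Convergence $T_{t_k}x\to x$ is with respect to the metric of $X$. *)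

(* Defs.v *)
From HB Require Import structures.
From mathcomp Require Import all_boot all_order all_algebra.
From mathcomp Require Import all_classical all_reals all_analysis.

Set Implicit Arguments.
Unset Strict Implicit.
Unset Printing Implicit Defensive.

Import Order.TTheory GRing.Theory Num.Theory.
Import numFieldNormedType.Exports.

Local Open Scope classical_set_scope.
Local Open Scope ring_scope.

(* The sigma-algebra is not assumed to be the Borel one; that it contains the
   open sets is stated separately by [borel_compatible]. *)
#[short(type="measurableMetricType")]
HB.structure Definition MeasurableMetric (d : measure_display)
    (R : numDomainType) := { X of Metric R X & Measurable d X }.

Section flows.
Context {d : measure_display} {R : realType} {X : measurableMetricType d R}.
Implicit Types (mu : probability X R) (T : R -> X -> X) (f : X -> R).

Definition borel_compatible (Y : measurableMetricType d R) :=
  forall U : set Y, open U -> measurable U.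

Definition open_positive mu :=
  forall U : set X, open U -> U !=set0 -> (0 < mu U)%E.

(* Each [T t] is invertible, with inverse [T (- t)], by the first two fields.
   Joint measurability is with respect to the product of the Borel
   sigma-algebra of [R] and the sigma-algebra of [X]. *)
Record preserving_flow mu T : Prop := PreservingFlow {
  flow0 : forall x, T 0 x = x ;
  flowD : forall s t x, T (s + t) x = T s (T t x) ;
  flow_measurable : measurable_fun setT
    (fun p : measurableTypeR R * X => T p.1 p.2) ;
  flow_preserving : forall t (A : set X), measurable A ->
    mu (T t @^-1` A) = mu A }.

Definition ergodic_flow mu T :=
  forall A : set X, measurable A -> (forall t, T t @^-1` A = A) ->
    mu A = 0%E \/ mu A = 1%E.

(* [Rintegral] returns a default value on non-integrable functions, so that the
   integral over the segment between 0 and [t] makes sense is a separate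
   condition, [orbit_integrable]; [orbit_integral] is the oriented integral from
   0 to [t]. *)
Definition orbit_integrable T f (t : R) (x : X) :=
  lebesgue_measure.-integrable `[Num.min 0 t, Num.max 0 t]
    (fun s : R => (f (T s x))%:E).

Definition orbit_integral T f (t : R) (x : X) : R :=
  if 0 <= t then \int[lebesgue_measure]_(s in `[0, t]) f (T s x)
  else - \int[lebesgue_measure]_(s in `[t, 0]) f (T s x).

End flows.

(* Main.v *)
(* Write sigma(t, x) for the integral of [f] along the orbit of [x] from 0 to
   [t].  By Lebesgue differentiation along orbits and Fubini, almost every [x]
   with [f x <> 0] lies in one of the sets G_c of points such that
   |sigma(s, x)| >= c s for 0 <= s < c.

   Let A be a measurable subset of G_c such that no x in A has a return T_t x
   in A with t > N and sigma(t, x) = 0.  Observe the visits of an orbit to A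
   during the windows [j m, j m + c/2], where m > N + c/2.  On the visits in
   one window sigma expands distances by c, and the values taken on visits in
   distinct windows are distinct, so the time spent in A during the first n
   windows is at most 1/c times the length of the range of sigma on [0, n m].
   This length is o(n) almost surely by the ergodic theorem and the zero mean,
   while the expected time is n (c/2) mu(A) by invariance.  Hence mu(A) = 0.

   Nonempty open sets being of positive measure, X is separable, and this can
   be applied to countably many sets G_c /\ B with B a small ball. *)
Require Import Defs.
From HB Require Import structures.
From mathcomp Require Import all_boot all_order all_algebra.
From mathcomp Require Import all_classical all_reals all_analysis.
From mathcomp Require Import measurable_realfun.
From mathcomp Require Import ring lra.

Set Implicit Arguments.
Unset Strict Implicit.
Unset Printing Implicit Defensive.

Import Order.TTheory GRing.Theory Num.Theory.
Import numFieldNormedType.Exports.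

Local Open Scope classical_set_scope.
Local Open Scope ring_scope.

Local Notation leb := lebesgue_measure.

(** * Archimedean bounds *)

Section archimedean.
Context {R : realType}.
Implicit Type x : R.

Lemma ltr_bound_nat x n : (Num.bound x <= n)%N -> x < n%:R.
Proof.
by move=> xn; apply: lt_le_trans (unstable.ltr_bound x) _; rewrite ler_nat.
Qed.

Lemma invr_bound_lt x : 0 < x -> (Num.bound x^-1).+1%:R^-1 < x.
Proof. by move=> x0; rewrite invf_plt ?posrE//; exact: ltr_bound_nat. Qed.

End archimedean.

(** * Integrals along orbits *)

Section shift.
Context {R : realType}.

Lemma measurable_shift (t : R) :
  measurable_fun [set: measurableTypeR R] (fun s => s + t : measurableTypeR R).
Proof. exact: measurable_funD. Qed.

(** The pushforward agrees with Lebesgue measure on half-open intervals, which determine it. *)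
Lemma lebesgue_measure_shift (t : R) (A : set R) : measurable A ->
  pushforward leb (fun s : measurableTypeR R => s + t : measurableTypeR R) A
    = leb A.
Proof.
move=> mA; apply/esym/lebesgue_measure_unique => //=.
  exact: measurable_shift.
move=> mf _ [[a b]] _ <-.
rewrite /pushforward (_ : _ @^-1` _ = `]a - t, b - t]%classic).
  rewrite !lebesgue_measure_itv/= !lte_fin ltrD2r.
  by case: ifP => //= _; congr (_%:E); lra.
by apply/seteqP; split => s /=; rewrite !in_itv/= ltrBlDr lerBrDr.
Qed.

Lemma preimage_shift_itv (a b t : R) :
  (fun s : R => s + t) @^-1` `[a + t, b + t] = `[a, b]%classic.
Proof. by apply/seteqP; split => s /=; rewrite !in_itv/= !lerD2r. Qed.

Lemma ge0_integral_shift (a b t : R) (phi : R -> \bar R) :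
  measurable_fun setT phi -> (forall s, 0 <= phi s)%E ->
  (\int[leb]_(s in `[a, b]) phi (s + t)%R =
   \int[leb]_(s in `[(a + t)%R, (b + t)%R]) phi s)%E.
Proof.
move=> mphi phi0.
rewrite -(preimage_shift_itv a b t).
rewrite -(@ge0_integral_pushforward _ _ _ _ _ _
  (measurable_shift t) leb _ phi)//.
- apply: eq_measure_integral => [|mp A mA _]; first exact: measurable_shift.
  exact: lebesgue_measure_shift.
- exact: measurable_funTS.
Qed.

Lemma integrable_shift (a b t : R) (phi : R -> R) :
  measurable_fun setT phi ->
  leb.-integrable `[a, b] (fun s => (phi (s + t))%:E) <->
  leb.-integrable `[a + t, b + t] (fun s => (phi s)%:E).
Proof.
move=> mphi; split=> /integrableP[_ H]; apply/integrableP; split.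
- apply/measurable_EFinP; exact: measurable_funTS.
- move: H.
  rewrite (ge0_integral_shift _ _ _ (phi := fun s => `|(phi s)%:E|%E))//.
  by apply: measurableT_comp => //; apply/measurable_EFinP.
- apply/measurable_EFinP; apply: measurable_funTS.
  exact: (measurableT_comp mphi (measurable_shift t)).
- rewrite (ge0_integral_shift _ _ _ (phi := fun s => `|(phi s)%:E|%E))//.
  by apply: measurableT_comp => //; apply/measurable_EFinP.
Qed.

(** Splitting into positive and negative parts reduces this to the nonnegative case. *)
Lemma Rintegral_shift (a b t : R) (phi : R -> R) :
  measurable_fun setT phi ->
  \int[leb]_(s in `[a, b]) phi (s + t) =
  \int[leb]_(s in `[a + t, b + t]) phi s.
Proof.
move=> mphi; rewrite /Rintegral integralE [in RHS]integralE.
have mE : measurable_fun setT (fun s => (phi s)%:E) by apply/measurable_EFinP.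
congr (fine (_ - _)).
- rewrite -(ge0_integral_shift a b t (measurable_funepos mE))//.
  apply: eq_integral => s _.
by rewrite !funeposE.
- rewrite -(ge0_integral_shift a b t (measurable_funeneg mE))//.
  by apply: eq_integral => s _; rewrite !funenegE.
Qed.

End shift.

Section orbits.
Context {d : measure_display} {R : realType} {X : measurableMetricType d R}.
Variables (mu : probability X R) (T : R -> X -> X).
Hypothesis Tflow : preserving_flow mu T.

Lemma measurable_flow t : measurable_fun setT (T t).
Proof. exact: (measurable_fun_pair2 t (flow_measurable Tflow)). Qed.

Lemma measurable_orbit x :
  measurable_fun [set: measurableTypeR R] (fun s => T s x).
Proof. exact: (measurable_fun_pair1 x (flow_measurable Tflow)). Qed.

Lemma ge0_integral_flow t (phi : X -> \bar R) :
  measurable_fun setT phi -> (forall x, 0 <= phi x)%E ->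
  (\int[mu]_x phi (T t x) = \int[mu]_x phi x)%E.
Proof.
move=> mphi phi0.
rewrite -(@ge0_integral_pushforward _ _ _ _ _ _
  (measurable_flow t) mu setT phi)//.
apply: eq_measure_integral => [|mp A mA _]; first exact: measurable_flow.
exact: (flow_preserving Tflow t mA).
Qed.

Lemma measurable_orbit_integral (D : set R) (phi : X -> \bar R) :
  measurable D -> measurable_fun setT phi -> (forall x, 0 <= phi x)%E ->
  measurable_fun setT (fun x => \int[leb]_(s in D) phi (T s x))%E.
Proof.
move=> mD mphi phi0.
under eq_fun do rewrite integral_mkcond.
(* The restriction to [D] becomes an indicator factor, so that Tonelli applies on the whole
   product. *)
pose h (p : measurableTypeR R * X) := (phi (T p.1 p.2) * (\1_D p.1)%:E)%E.
have mh : measurable_fun setT h.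
  apply: emeasurable_funM.
    exact: (measurableT_comp mphi (flow_measurable Tflow)).
  apply/measurable_EFinP/measurableT_comp => //.
have h0 p : (0 <= h p)%E by rewrite /h mule_ge0.
have := measurable_fun_fubini_tonelli_G (m1 := leb) h mh h0.
apply: eq_measurable_fun => x _; apply: eq_integral => s _.
by rewrite /h /= epatch_indic.
Qed.

(** Tonelli puts the integral over [X] inside, where invariance makes it independent of the time
    [s]. *)
Lemma integral_orbit_integral (D : set R) (phi : X -> \bar R) :
  measurable D -> measurable_fun setT phi -> (forall x, 0 <= phi x)%E ->
  (\int[mu]_x \int[leb]_(s in D) phi (T s x) = leb D * \int[mu]_x phi x)%E.
Proof.
move=> mD mphi phi0.
under eq_integral do rewrite integral_mkcond.
pose h (p : measurableTypeR R * X) := (phi (T p.1 p.2) * (\1_D p.1)%:E)%E.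
have mh : measurable_fun setT h.
  apply: emeasurable_funM.
    exact: (measurableT_comp mphi (flow_measurable Tflow)).
  apply/measurable_EFinP/measurableT_comp => //.
have h0 p : (0 <= h p)%E by rewrite /h mule_ge0.
transitivity (\int[mu]_x \int[leb]_s h (s, x))%E.
  apply: eq_integral => x _; apply: eq_integral => s _.
  by rewrite /h /= epatch_indic.
rewrite -(fubini_tonelli h)//.
transitivity (\int[leb]_s ((\int[mu]_x phi x) * (\1_D s)%:E))%E.
  apply: eq_integral => s _; rewrite /h/= ge0_integralZr//; last first.
    exact: (measurableT_comp mphi (measurable_flow s)).
  by rewrite (ge0_integral_flow s mphi).
rewrite ge0_integralZl//.
- by rewrite integral_indic// setIT muleC.
- exact/measurable_EFinP.
- exact: integral_ge0.
Qed.

End orbits.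

(* Windows around 0 are two-sided so that this set is invariant under [T t] for
   every real [t]. *)
Definition regular_orbit {d : measure_display} {R : realType}
    {X : measurableMetricType d R} (T : R -> X -> X) (f : X -> R) : set X :=
  [set x | forall n : nat,
    leb.-integrable `[- n%:R, n%:R] (fun s => (f (T s x))%:E)].

(* For [t < 0] the interval is empty and the value is 0; in particular the
   cocycle is continuous in [t] on the whole line. *)
Definition cocycle {d : measure_display} {R : realType}
    {X : measurableMetricType d R} (T : R -> X -> X) (f : X -> R)
    (t : R) (x : X) : R := \int[leb]_(s in `[0, t]) f (T s x).

Section cocycle.
Context {d : measure_display} {R : realType} {X : measurableMetricType d R}.
Variables (mu : probability X R) (T : R -> X -> X) (f : X -> R).
Hypothesis Tflow : preserving_flow mu T.
Hypothesis mf : measurable_fun setT f.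
Local Notation regular := (regular_orbit T f).
Local Notation sg := (cocycle T f).

Lemma measurable_orbit_fun x :
  measurable_fun [set: R] (fun s => f (T s x)).
Proof. exact: (measurableT_comp mf (measurable_orbit Tflow x)). Qed.

Lemma regular_integrable x a b : regular x ->
  leb.-integrable `[a, b] (fun s => (f (T s x))%:E).
Proof.
move=> rx; pose n := Num.bound (`|a| + `|b|).
have nab : `|a| + `|b| < n%:R by exact: archi_boundP.
apply: integrableS (rx n) => //.
move=> s /=; rewrite !in_itv/= => /andP[sa sb]; apply/andP; split.
- have := ler_norm (- a); rewrite normrN; have := normr_ge0 b; lra.
- have := ler_norm b; have := normr_ge0 a; lra.
Qed.

Lemma regular_orbitP x : regular x <-> forall n : nat,
  (\int[leb]_(s in `[(- n%:R)%R, n%:R]) `|(f (T s x))%:E| < +oo)%E.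
Proof.
split=> rx n; first by have /integrableP[] := rx n.
apply/integrableP; split => //; apply/measurable_EFinP.
exact: measurable_funTS (measurable_orbit_fun x).
Qed.

Lemma measurable_regular : measurable regular.
Proof.
have -> : regular = \bigcap_n [set x |
    (\int[leb]_(s in `[(- n%:R)%R, n%:R]) `|(f (T s x))%:E| < +oo)%E].
  by apply/seteqP; split => x => [/regular_orbitP rx n _|rx];
    [exact: rx|apply/regular_orbitP => n; exact: rx].
apply: bigcapT_measurable => n.
have mI := measurable_orbit_integral Tflow (D := `[- n%:R, n%:R])
  (phi := fun x => `|(f x)%:E|%E) _ _ _.
rewrite -[X in measurable X]setTI; apply: emeasurable_fun_infty_o => //.
apply: mI => //; apply: measurableT_comp => //; exact/measurable_EFinP.
Qed.

Lemma regular_flow t x : regular x -> regular (T t x).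
Proof.
move=> rx n.
rewrite (_ : (fun s => _) = (fun s => (f (T (s + t)%R x))%:E)); last first.
  by apply/funext => s; rewrite (flowD Tflow).
apply/(integrable_shift _ _ _ (measurable_orbit_fun x)).
exact: regular_integrable.
Qed.

(** The integral of [|f|] along an orbit window has a finite mean over [mu], by Tonelli, hence is
    finite almost everywhere; there are countably many windows. *)
Lemma ae_regular : mu.-integrable setT (fun x => (f x)%:E) ->
  {ae mu, forall x, regular x}.
Proof.
move=> /integrableP[_ intf].
suff : forall n : nat, {ae mu, forall x,
    (\int[leb]_(s in `[(- n%:R)%R, n%:R]) `|(f (T s x))%:E| < +oo)%E}.
  by move=> /ae_foralln; apply: filterS => x rx; exact/regular_orbitP.
move=> n.
have mabs : measurable_fun setT (fun x => `|(f x)%:E|%E).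
  apply: measurableT_comp => //; exact/measurable_EFinP.
have mI := measurable_orbit_integral Tflow (D := `[- n%:R, n%:R]) _ mabs
  (fun=> abse_ge0 _).
have := integral_orbit_integral Tflow (D := `[- n%:R, n%:R]) _ mabs
  (fun=> abse_ge0 _).
move=> /(_ (measurable_itv _)).
set J := fun x => (\int[leb]_(s in `[(- n%:R)%R, n%:R]) `|(f (T s x))%:E|)%E.
rewrite -/J => IE.
have /integrable_ae : mu.-integrable setT J.
  apply/integrableP; split; first exact: mI.
  under eq_integral do rewrite gee0_abs ?integral_ge0//.
  rewrite IE lebesgue_measure_itv/=; case: ifPn => _; rewrite ?mul0e//.
  by rewrite -EFinD lte_mul_pinfty// ?lee_fin; have := ler0n R n; lra.
move=> /(_ measurableT); apply: filterS => x /(_ Logic.I).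
by rewrite ge0_fin_numE// integral_ge0.
Qed.

Lemma cocycle0 x : sg 0 x = 0.
Proof. by rewrite /cocycle set_itv1 Rintegral_set1. Qed.

Lemma cocycle_lt0 t x : t < 0 -> sg t x = 0.
Proof.
move=> t0; rewrite /cocycle set_itv_ge ?Rintegral_set0//.
by rewrite bnd_simp -ltNge.
Qed.

Lemma Rintegral_itvD x a b c : regular x -> a <= b -> b <= c ->
  \int[leb]_(s in `[a, c]) f (T s x) =
  \int[leb]_(s in `[a, b]) f (T s x) + \int[leb]_(s in `[b, c]) f (T s x).
Proof.
move=> rx ab bc.
rewrite (@itv_bndbnd_setU _ _ _ (BRight b))// ?bnd_simp//.
rewrite Rintegral_setU//=.
- rewrite Rintegral_itv_obnd_cbnd//.
  apply: integrableS (regular_integrable b c rx) => //.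
  exact: subset_itv_oc_cc.
- rewrite -itv_bndbnd_setU ?bnd_simp//; exact: regular_integrable.
- apply/disj_setPS => s/= [] ; rewrite !in_itv/= => /andP[_ sb] /andP[bs _].
  by move: bs; rewrite ltNge sb.
Qed.

(** Cut the segment at [u] and move the second piece back to the origin by the flow. *)
Lemma cocycleD x t u : regular x -> 0 <= t -> 0 <= u ->
  sg (t + u) x = sg u x + sg t (T u x).
Proof.
move=> rx t0 u0; rewrite /cocycle (@Rintegral_itvD _ _ u)//; last lra.
congr (_ + _); under [RHS]eq_Rintegral do rewrite -(flowD Tflow).
rewrite (Rintegral_shift _ _ _ (measurable_orbit_fun x)).
by rewrite add0r.
Qed.

Lemma continuous_cocycle x : regular x -> continuous (sg ^~ x).
Proof.
move=> rx.
have c b : 0 < b -> {within `[0, b], continuous (sg ^~ x)}.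
  move=> b0; apply: parameterized_integral_continuous (ltW b0) _.
  exact: regular_integrable.
move=> t; have [t0|t0|t0] := ltgtP t 0.
- apply: cvg_near_cst; near=> u; rewrite !cocycle_lt0//.
  by near: u; exact: lt_nbhsl.
- have tt : t < t + 1 by rewrite ltrDl.
  have := c (t + 1); rewrite continuous_within_itvP; last lra.
  move=> /(_ _)[]; first lra.
  by move=> ct _ _; apply: ct; rewrite in_itv/= t0.
(* At 0 the left limit comes from the value 0 at negative times, the right one from continuity of
   the integral in its endpoint. *)
- rewrite t0; apply/left_right_continuousP; split.
    by apply: cvg_near_cst; near=> u; rewrite cocycle0 cocycle_lt0.
  by have := c 1 ltr01; rewrite continuous_within_itvP// => -[].
Unshelve. all: by end_near. Qed.

(** The cocycle is [fine] of a difference of two Tonelli integrals, each measurable on the whole of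
    [X]. *)
Lemma measurable_cocycle t : measurable_fun setT (sg t).
Proof.
have mE : measurable_fun setT (fun x => (f x)%:E) by exact/measurable_EFinP.
have mp := measurable_orbit_integral Tflow (D := `[0, t]) (measurable_itv _)
  (measurable_funepos mE) (funepos_ge0 _).
have mn := measurable_orbit_integral Tflow (D := `[0, t]) (measurable_itv _)
  (measurable_funeneg mE) (funeneg_ge0 _).
apply: (measurableT_comp (fine_measurable measurableT)).
rewrite [X in measurable_fun _ X](_ : _ =
    ((fun x => \int[leb]_(s in `[0%R, t]) (fun y => (f y)%:E)^\+ (T s x)) \-
     (fun x => \int[leb]_(s in `[0%R, t]) (fun y => (f y)%:E)^\- (T s x)))%E).
  exact: emeasurable_funB.
apply/funext => x /=; rewrite integralE; congr (_ - _)%E.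
- by apply: eq_integral => s _; rewrite !funeposE.
- by apply: eq_integral => s _; rewrite !funenegE.
Qed.

End cocycle.

(** * Sublinear growth of the cocycle *)

Section integrability.
Context {d : measure_display} {R : realType} {X : measurableMetricType d R}.
Variables (mu : probability X R) (T : R -> X -> X).
Hypothesis Tflow : preserving_flow mu T.

Lemma integrable_EFin_measurable (phi : X -> R) :
  mu.-integrable setT (EFin \o phi) -> measurable_fun setT phi.
Proof. by move=> /measurable_int/measurable_EFinP. Qed.

Lemma integrable_maxr (phi psi : X -> R) :
  mu.-integrable setT (EFin \o phi) -> mu.-integrable setT (EFin \o psi) ->
  mu.-integrable setT (EFin \o (fun x => Num.max (phi x) (psi x))).
Proof.
move=> iphi ipsi.
apply: (le_integrable measurableT _ _ (integrableD measurableT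
  (integrable_abse iphi) (integrable_abse ipsi))) => /=.
  apply/measurable_EFinP; apply: measurable_maxr;
    exact: integrable_EFin_measurable.
move=> x _; rewrite lee_fin (@ger0_norm _ (_ + _)) ?addr_ge0//.
by rewrite /Num.max; case: ifPn => _; rewrite ?lerDl ?lerDr.
Qed.

Lemma integrable_flow t (phi : X -> R) : mu.-integrable setT (EFin \o phi) ->
  mu.-integrable setT (EFin \o (fun x => phi (T t x))).
Proof.
move=> iphi; have mphi := integrable_EFin_measurable iphi.
apply/integrableP; split.
  exact/measurable_EFinP/(measurableT_comp mphi (measurable_flow Tflow t)).
rewrite /= (ge0_integral_flow Tflow t (phi := fun x => `|(phi x)%:E|%E))//.
  by have /integrableP[] := iphi.
by apply: measurableT_comp => //; apply/measurable_EFinP.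
Qed.

Lemma Rintegral_flow t (phi : X -> R) : measurable_fun setT phi ->
  \int[mu]_x phi (T t x) = \int[mu]_x phi x.
Proof.
move=> mphi; rewrite /Rintegral integralE [in RHS]integralE.
have mE : measurable_fun setT (fun x => (phi x)%:E) by apply/measurable_EFinP.
congr (fine (_ - _)).
- rewrite -(ge0_integral_flow Tflow t (measurable_funepos mE))//.
  by apply: eq_integral => s _; rewrite !funeposE.
- rewrite -(ge0_integral_flow Tflow t (measurable_funeneg mE))//.
  by apply: eq_integral => s _; rewrite !funenegE.
Qed.

End integrability.

(** * A maximal ergodic inequality *)

Section maximal.
Context {d : measure_display} {R : realType} {X : measurableMetricType d R}.
Variables (mu : probability X R) (T : R -> X -> X).
Hypothesis Tflow : preserving_flow mu T.
Variables (F h : X -> R).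

(** Unfolded along the iterates of [T 1], this is the maximum over [k <= n] of the Birkhoff sum of
    [h] over the first [k] points plus the value of [F] at the next one. *)
Fixpoint maximal_sum (n : nat) (x : X) : R :=
  if n is n'.+1 then Num.max (F x) (h x + maximal_sum n' (T 1 x)) else F x.
Local Notation M := maximal_sum.

Lemma maximal_sumS n x : M n x <= M n.+1 x.
Proof.
elim: n x => [|n IH] x; first by rewrite /= le_max lexx.
rewrite [leLHS]/= ge_max /=; rewrite !le_max lexx/=.
by rewrite lerD2l IH orbT.
Qed.

Lemma maximal_sum_homo x : {homo M ^~ x : m n / (m <= n)%N >-> m <= n}.
Proof.
by apply: homo_leq => [//|? ? ?|n]; [exact: le_trans|exact: maximal_sumS].
Qed.

Hypothesis iF : mu.-integrable setT (EFin \o F).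
Hypothesis ih : mu.-integrable setT (EFin \o h).

Lemma integrable_maximal_sum n : mu.-integrable setT (EFin \o M n).
Proof.
elim: n => [//|n IH]; apply: integrable_maxr => //.
exact: (integrableD measurableT ih (integrable_flow Tflow 1 IH)).
Qed.

(* [M n.+1 - (h + M n \o T 1)] is nonnegative with integral at least
   [- \int h], by invariance and monotonicity of [M], and it decreases to 0
   where [M] is unbounded. *)
Lemma maximal_ergodic :
  {ae mu, forall x, forall C, exists n, C < M n (T 1 x)} ->
  0 <= \int[mu]_x h x.
Proof.
move=> Minfty.
(* In this form [K n x] visibly decreases in [n] and vanishes once [M n (T 1 x)] exceeds
   [F x - h x]. *)
pose K n x := Num.max (F x - (h x + M n (T 1 x))) 0.
have ihM n : mu.-integrable setT (EFin \o (fun x => h x + M n (T 1 x))).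
  exact: (integrableD measurableT ih
            (integrable_flow Tflow 1 (integrable_maximal_sum n))).
have iK n : mu.-integrable setT (EFin \o K n).
  apply: integrable_maxr; last exact: integrable0.
  exact: (integrableB measurableT iF (ihM n)).
have KE n x : K n x = M n.+1 x - (h x + M n (T 1 x)).
  by rewrite /K/=; rewrite -[0 in LHS](subrr (h x + M n (T 1 x))) -addr_maxl.
have intK n : - (\int[mu]_x h x) <= \int[mu]_x K n x.
  have -> : \int[mu]_x K n x = \int[mu]_x (M n.+1 x - (h x + M n (T 1 x))).
    by apply: eq_Rintegral => x _; rewrite KE.
  rewrite RintegralB//; last exact: integrable_maximal_sum.
  rewrite RintegralD//; last first.
    exact: (integrable_flow Tflow 1 (integrable_maximal_sum n)).
  rewrite (Rintegral_flow Tflow 1); last first.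
    exact: integrable_EFin_measurable (integrable_maximal_sum n).
  have : \int[mu]_x M n x <= \int[mu]_x M n.+1 x.
    by apply: le_Rintegral => //; [exact: integrable_maximal_sum..|
      move=> x _; exact: maximal_sumS].
  lra.
have Kcvg : {ae mu, forall x, [set: X] x ->
    (EFin \o K n) x @[n --> \oo] --> (cst 0%E : X -> \bar R) x}.
  apply: filterS Minfty => x Mx _.
  have [n0 Mn0] := Mx (F x - h x).
  apply: cvg_near_cst; exists n0 => // n /= n0n.
  congr (_%:E); apply/max_idPr.
  by have := maximal_sum_homo (T 1 x) n0n; lra.
have Kdom : {ae mu, forall x n, [set: X] x ->
    (`|(EFin \o K n) x| <= (EFin \o K 0%N) x)%E}.
  apply: aeW => x n _ /=; rewrite lee_fin ger0_norm; last first.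
    by rewrite /K le_max lexx orbT.
  rewrite /K ge_max !le_max lexx !orbT andbT.
  by have := maximal_sum_homo (T 1 x) (leq0n n) => ?; rewrite lerB ?lerD2l.
have [_ _] := dominated_convergence measurableT
  (fun n => measurable_int _ (iK n)) (measurable_cst 0%E) Kcvg (iK 0%N) Kdom.
rewrite integral_cst// mul0e => cvgK.
have /(cvge_ge _) := cvgK; move=> /(_ (- (\int[mu]_x h x))%:E) ge.
suff : ((- (\int[mu]_x h x))%:E <= 0)%E by rewrite lee_fin oppr_le0.
apply: ge; apply: nearW => n /=.
have := fineK (integrable_fin_num measurableT (iK n)); rewrite /= => <-.
by rewrite lee_fin; exact: intK.
Qed.

End maximal.

Section cocycle_integral.
Context {d : measure_display} {R : realType} {X : measurableMetricType d R}.
Variables (mu : probability X R) (T : R -> X -> X) (f : X -> R).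
Hypothesis Tflow : preserving_flow mu T.
Hypothesis intf : mu.-integrable setT (EFin \o f).

Let mf : measurable_fun setT f := integrable_EFin_measurable intf.

Let I (g : X -> \bar R) t x := (\int[leb]_(s in `[0%R, t]) g (T s x))%E.

Let I_integrable (g : X -> \bar R) t :
  measurable_fun setT g -> (forall x, 0 <= g x)%E -> (\int[mu]_x g x < +oo)%E ->
  mu.-integrable setT (I g t).
Proof.
move=> mg g0 gfin; apply/integrableP; split.
  exact: (measurable_orbit_integral Tflow).
under eq_integral do rewrite gee0_abs ?integral_ge0//.
rewrite (integral_orbit_integral Tflow)// lebesgue_measure_itv/=.
case: ifPn; rewrite ?mul0e// lte_fin => t0.
by rewrite -EFinD lte_mul_pinfty// ?lee_fin; lra.
Qed.

Let IE t : (fun x => \int[leb]_(s in `[0%R, t]) (f (T s x))%:E)%E =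
  (I (EFin \o f)^\+ t \- I (EFin \o f)^\- t)%E.
Proof.
apply/funext => x; rewrite integralE /I; congr (_ - _)%E.
- by apply: eq_integral => s _; rewrite !funeposE.
- by apply: eq_integral => s _; rewrite !funenegE.
Qed.

Let Ip_integrable t : mu.-integrable setT (I (EFin \o f)^\+%E t).
Proof.
apply: I_integrable => //; first exact/measurable_funepos/measurable_EFinP.
exact: integral_funepos_lt_pinfty intf.
Qed.

Let In_integrable t : mu.-integrable setT (I (EFin \o f)^\-%E t).
Proof.
apply: I_integrable => //; first exact/measurable_funeneg/measurable_EFinP.
exact: integral_funeneg_lt_pinfty intf.
Qed.

Lemma integrable_cocycle t : mu.-integrable setT (EFin \o cocycle T f t).
Proof.
have := integrableB measurableT (Ip_integrable t) (In_integrable t).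
rewrite -IE; apply: le_integrable => //.
  apply/measurable_EFinP; exact: (measurable_cocycle Tflow mf).
move=> x _; rewrite /cocycle /Rintegral /=.
(* Where the extended integral is infinite, [fine] returns 0 and the bound still holds. *)
by case: (integral _ _ _) => [r| |] /=; rewrite ?normr0 ?leey.
Qed.

(** On regular orbits [fine] loses nothing, and by Tonelli over a segment of length 1 the positive
    and negative parts keep their means. *)
Lemma Rintegral_cocycle1 : \int[mu]_x cocycle T f 1 x = \int[mu]_x f x.
Proof.
rewrite [in LHS]/Rintegral.
have -> : (\int[mu]_x (cocycle T f 1 x)%:E =
    \int[mu]_x (I (EFin \o f)^\+ 1 x - I (EFin \o f)^\- 1 x))%E.
  apply: ae_eq_integral => //.
  - apply/measurable_EFinP; exact: (measurable_cocycle Tflow mf).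
  - apply: emeasurable_funB; [exact: measurable_int (Ip_integrable 1)|
      exact: measurable_int (In_integrable 1)].
  apply: filterS (ae_regular Tflow mf intf) => x rx _.
  have := congr1 (@^~ x) (IE 1) => /= <-; rewrite /cocycle fineK//.
  exact: (integrable_fin_num _ (regular_integrable 0 1 rx)).
rewrite integralB// ?Ip_integrable ?In_integrable// /Rintegral.
have mE : measurable_fun setT (fun x => (f x)%:E) by apply/measurable_EFinP.
rewrite (integral_orbit_integral Tflow _ (measurable_funepos mE))//.
rewrite (integral_orbit_integral Tflow _ (measurable_funeneg mE))//.
rewrite lebesgue_measure_itv/= lte_fin ltr01 oppr0 adde0 !mul1e.
by rewrite [in RHS]integralE.
Qed.

End cocycle_integral.

(** * The drift along almost every orbit *)

Section drift.
Context {d : measure_display} {R : realType} {X : measurableMetricType d R}.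
Variables (mu : probability X R) (T : R -> X -> X).
Hypothesis Tflow : preserving_flow mu T.

Section one_sided.
Variables (f : X -> R) (a : R).
Hypothesis intf : mu.-integrable setT (EFin \o f).
Hypothesis a0 : 0 < a.
Let mf : measurable_fun setT f := integrable_EFin_measurable intf.
Local Notation sg := (cocycle T f).

Lemma ler_norm_cocycle t u x : regular_orbit T f x -> t <= u ->
  `|sg t x| <= cocycle T (fun y => `|f y|) u x.
Proof.
move=> rx tu.
apply: (le_trans (le_normr_Rintegral _ (regular_integrable 0 t rx))) => //.
apply: fine_le.
- exact: (integrable_fin_num _ (integrable_abse (regular_integrable 0 t rx))).
- exact: (integrable_fin_num _ (integrable_abse (regular_integrable 0 u rx))).
apply: ge0_subset_integral => //.
- apply/measurable_EFinP; apply: measurable_funTS.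
  apply: measurableT_comp => //.
  exact: (measurable_orbit_fun Tflow mf).
- by apply: subset_itvl; rewrite bnd_simp.
Qed.

(* Taking the supremum of [sg t x - a * t] over real [t] makes this set invariant
   in the strict sense required by [ergodic_flow]. *)
Let unbounded := [set x | regular_orbit T f x /\
  forall C : nat, exists t, 0 <= t /\ C%:R < sg t x - a * t].

Let unbounded_measurable : measurable unbounded.
Proof.
(* By continuity of the cocycle, a real time can be replaced by a slightly later rational one. *)
have -> : unbounded = regular_orbit T f `&` \bigcap_(C : nat) \bigcup_(q : rat)
    [set x | 0 <= ratr q :> R /\ C%:R < sg (ratr q) x - a * ratr q].
  apply/seteqP; split => x [rx Hx]; split=> // C; last first.
    by have [q _ [q0 qC]] := Hx C Logic.I; exists (ratr q).
  move=> _; have [t [t0 tC]] := Hx C.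
  have ct : {for t, continuous (fun u => sg u x - a * u)}.
    apply: cvgB; first exact: (continuous_cocycle rx).
    exact: cvgM (cvg_cst _) cvg_id.
  have /nbhs_ballP[e /= e0 He] := ct _ (lt_nbhsr tC).
  have [q] := @rat_in_itvoo R t (t + e) ltac:(by rewrite ltrDl).
  rewrite in_itv/= => /andP[tq qe].
  exists q => //; split; first lra.
  apply: He; rewrite /ball/= ltr_norml; lra.
apply: measurableI; first exact: (measurable_regular Tflow).
apply: bigcapT_measurable => C; apply: bigcupT_measurable_rat => q.
have [q0|q0] := leP 0 (ratr q : R); last first.
  rewrite [X in measurable X](_ : _ = set0)//.
  by apply/seteqP; split => x //= [].
rewrite [X in measurable X](_ : _ =
    [set x | (C%:R < sg (ratr q) x - a * ratr q)%R]); last first.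
  by apply/seteqP; split => x /= [].
rewrite -[X in measurable X]setTI.
apply: (measurable_fun_ltr (f := cst C%:R)) => //.
by apply: measurable_funB => //; exact: (measurable_cocycle Tflow).
Qed.

Let unboundedR x (C : R) : unbounded x ->
  exists t, 0 <= t /\ C < sg t x - a * t.
Proof.
move=> [_ /(_ (Num.bound C))[t [t0 Ct]]]; exists t; split=> //.
by apply: le_lt_trans Ct; apply/ltW; exact: ltr_bound_nat.
Qed.

Let unbounded_flow t x : unbounded x -> unbounded (T t x).
Proof.
move=> ux; have rx := ux.1; split; first exact: (regular_flow Tflow mf).
have rTx := regular_flow Tflow mf t rx.
move=> C; have [t0|t0] := leP 0 t.
(* [B] bounds the cocycle on [[0, t]], so an excess above it forces [u] past [t], and [u - t] is
   then a suitable time for [T t x]. *)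
- pose B := cocycle T (fun y => `|f y|) t x.
  have [u [u0 Hu]] := unboundedR (C%:R + B + `|sg t x|) ux.
  have tu : t <= u.
    rewrite leNgt; apply/negP => ut.
    have := ler_norm_cocycle rx (ltW ut); rewrite -/B => uB.
    have := mulr_ge0 (ltW a0) u0; have := normr_ge0 (sg t x).
    have := ler_norm (sg u x); have := ler0n R C; lra.
  exists (u - t); split; first lra.
  have := @cocycleD _ _ _ _ _ _ Tflow mf x (u - t) t rx ltac:(lra) t0.
  rewrite subrK => E.
  have := mulr_ge0 (ltW a0) t0; have := ler_norm (sg t x).
  have : 0 <= B by apply: le_trans (ler_norm_cocycle rx (lexx t)).
  rewrite mulrBr; lra.
- have [u [u0 Hu]] := unboundedR (C%:R + `|sg (- t) (T t x)| - a * t) ux.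
  exists (u - t); split; first lra.
  have := @cocycleD _ _ _ _ _ _ Tflow mf (T t x) u (- t) rTx u0 ltac:(lra).
  rewrite -(flowD Tflow) addNr (flow0 Tflow) => ->.
  have := ler_norm (- sg (- t) (T t x)); rewrite normrN.
  rewrite mulrBr; lra.
Qed.

Let unbounded_inv t : T t @^-1` unbounded = unbounded.
Proof.
apply/seteqP; split => x /=; last exact: unbounded_flow.
by move=> /(@unbounded_flow (- t)); rewrite -(flowD Tflow) addNr (flow0 Tflow).
Qed.

(** [F] dominates the cocycle at all times up to 1; it absorbs the fractional part of a real time,
    while [h] is the net gain of a unit step. *)
Let F : X -> R := cocycle T (fun y => `|f y|) 1.
Let h x : R := sg 1 x - a.

(** Peel off unit steps by the cocycle identity until the time left is at most 1, where [F] takes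
    over. *)
Let maximal_sum_ge n x t : regular_orbit T f x -> 0 <= t <= n.+1%:R ->
  sg t x - a * t <= maximal_sum T F h n x.
Proof.
have small m y u : regular_orbit T f y -> 0 <= u <= 1 ->
    sg u y - a * u <= maximal_sum T F h m y.
  move=> ry /andP[u0 u1].
  apply: (@le_trans _ _ (F y)); last by case: m => //= m; rewrite le_max lexx.
  have := ler_norm_cocycle ry u1; have := ler_norm (sg u y).
  have := mulr_ge0 (ltW a0) u0; rewrite /F; lra.
elim: n x t => [|n IH] x t rx /andP[t0 tn].
  by apply: small => //; rewrite t0.
have [t1|t1] := leP t 1; first by apply: small => //; rewrite t0.
rewrite /= le_max; apply/orP; right.
have := @cocycleD _ _ _ _ _ _ Tflow mf x (t - 1) 1 rx ltac:(lra) ler01.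
rewrite subrK => ->.
have := IH (T 1 x) (t - 1) (regular_flow Tflow mf 1 rx).
rewrite -[n.+2]addn1 natrD in tn.
have tn1 : 0 <= t - 1 <= n.+1%:R by apply/andP; split; lra.
move=> /(_ tn1).
rewrite /h mulrBr; lra.
Qed.

Hypothesis erg : ergodic_flow mu T.
Hypothesis intf0 : \int[mu]_x f x = 0.

(** By ergodicity [unbounded] is null or of full measure. In the second case the maximal inequality
    gives [h] a nonnegative mean, but this mean is [- a]. *)
Lemma cocycle_drift_le :
  {ae mu, forall x, exists C, forall t, 0 <= t -> sg t x <= a * t + C}.
Proof.
have [U0|U1] := erg unbounded_measurable unbounded_inv.
  have nU : {ae mu, forall x, ~ unbounded x}.
    exists unbounded; split => // x /=; exact: contrapT.
  apply: filterS2 nU (ae_regular Tflow mf intf) => x nUx rx.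
  apply: contrapT => H; apply: nUx; split=> // C.
  apply: contrapT => H'; apply: H; exists C%:R => t t0.
  by rewrite leNgt; apply/negP => tC; apply: H'; exists t; split => //; lra.
exfalso.
have iF : mu.-integrable setT (EFin \o F).
  by apply: (integrable_cocycle Tflow); exact: integrable_norm.
have ih : mu.-integrable setT (EFin \o h).
  exact: (integrableB measurableT (integrable_cocycle Tflow intf 1)
    (finite_measure_integrable_cst mu a measurableT)).
have aeU : {ae mu, forall x, unbounded x}.
  exists (~` unbounded); split => //.
    exact: measurableC.
  by rewrite probability_setC// U1 subee.
have : 0 <= \int[mu]_x h x.
  apply: (maximal_ergodic Tflow iF ih); apply: filterS aeU => x ux C.
  have uTx := unbounded_flow 1 ux.
  have [t [t0 Ct]] := unboundedR C uTx.
  exists (Num.bound t); apply: (lt_le_trans Ct).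
  apply: maximal_sum_ge; first exact: uTx.1.
  by rewrite t0/= ltW// ltr_bound_nat.
rewrite RintegralB//; last 2 first.
- exact: integrable_cocycle Tflow intf 1.
- exact: finite_measure_integrable_cst.
rewrite (Rintegral_cocycle1 Tflow intf) intf0 Rintegral_cst//.
set z := fine _; have -> : z = 1 by exact: (congr1 fine (probability_setT mu)).
by rewrite mulr1 sub0r oppr_ge0 leNgt a0.
Qed.

End one_sided.

Variable f : X -> R.
Hypothesis intf : mu.-integrable setT (EFin \o f).
Hypothesis erg : ergodic_flow mu T.
Hypothesis intf0 : \int[mu]_x f x = 0.

(** Combine the one-sided bounds for [f] and [- f]. The slopes [n.+1%:R^-1] suffice, which leaves
    countably many exceptional null sets. *)
Lemma cocycle_drift : {ae mu, forall x, forall a, 0 < a ->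
  exists C, forall t, 0 <= t -> `|cocycle T f t x| <= a * t + C}.
Proof.
have mf := integrable_EFin_measurable intf.
have intN : mu.-integrable setT (EFin \o (fun x => - f x)).
  exact: (integrableN intf).
have intN0 : \int[mu]_x (- f x) = 0.
  under eq_Rintegral do rewrite -mulN1r.
  by rewrite RintegralZl// intf0 mulr0.
suff : {ae mu, forall x, forall n : nat, exists C, forall t, 0 <= t ->
    `|cocycle T f t x| <= n.+1%:R^-1 * t + C}.
  apply: filterS => x Hx a a0.
  have [C HC] := Hx (Num.bound a^-1).
  exists C => t t0; apply: (le_trans (HC t t0)); rewrite lerD2r ler_wpM2r//.
  by rewrite ltW// invr_bound_lt.
apply/ae_foralln => n.
have n0 : 0 < n.+1%:R^-1 :> R by [].
apply: filterS3 (cocycle_drift_le intf n0 erg intf0)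
  (cocycle_drift_le intN n0 erg intN0) (ae_regular Tflow mf intf).
move=> x [C1 HC1] [C2 HC2] rx.
exists (`|C1| + `|C2|) => t t0.
have := HC2 _ t0; have := HC1 _ t0.
have -> : cocycle T (fun y => - f y) t x = - cocycle T f t x.
  rewrite /cocycle; under eq_Rintegral do rewrite -mulN1r.
  by rewrite (RintegralZl _ _ (regular_integrable 0 t rx)) ?mulN1r.
have := ler_norm C1; have := ler_norm C2.
have := normr_ge0 C1; have := normr_ge0 C2.
move: (_^-1 * t) => z *; rewrite ler_norml; apply/andP; split; lra.
Qed.

End drift.

(** * Expanding points and returns *)

Section expanding.
Context {R : realType}.

Lemma le_lebesgue_measure (A B : set R) : measurable A -> measurable B ->
  A `<=` B -> (leb A <= leb B)%E.
Proof. by move=> mA mB AB; apply: le_measure; rewrite ?inE. Qed.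

Lemma lebesgue_measure_le_diam (S : set R) (e : R) :
  measurable S -> 0 <= e -> (forall s t, S s -> S t -> t - s <= e) ->
  (leb S <= e%:E)%E.
Proof.
move=> mS e0 Se; have [->|/set0P[x0 Sx0]] := eqVneq S set0.
  by rewrite measure0 lee_fin.
have lbS : has_lbound S.
  by exists (x0 - e) => s Ss; have := Se _ _ Ss Sx0; lra.
have SI : S `<=` `[inf S, inf S + e].
  move=> s Ss /=; rewrite in_itv/= ge_inf//= -lerBlDr.
  apply: lb_le_inf; first by exists x0.
  by move=> t St; have := Se _ _ St Ss; lra.
apply: (le_trans (le_lebesgue_measure _ _ SI)) => //.
rewrite lebesgue_measure_itv/= lte_fin; case: ifPn => _.
  by rewrite -EFinD addrAC subrr add0r.
by rewrite lee_fin.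
Qed.

Variables (g : R -> R) (c : R).
Hypothesis c0 : 0 < c.

(** Lebesgue measure is an infimum over countable covers by half-open intervals. By expansion, the
    part of [K] sent into an interval of length [l] has diameter at most [l / c]. *)
Lemma lebesgue_measure_expanding (K B : set R) :
  measurable_fun setT g -> measurable K -> measurable B ->
  (forall s t, K s -> K t -> s <= t -> c * (t - s) <= `|g t - g s|) ->
  (c%:E * leb (K `&` g @^-1` B) <= leb B)%E.
Proof.
move=> mg mK mB Kg.
have mKg A : measurable A -> measurable (K `&` g @^-1` A).
  move=> mA; apply: measurableI => //.
  by rewrite -[X in measurable X]setTI; exact: mg.
apply: le_ereal_inf_tmp => _ [A [mA BA] <-].
have mA' k : measurable (A k : set (measurableTypeR R)).
  by apply: sub_sigma_algebra; exact: mA.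
apply: (@le_trans _ _ (c%:E * \sum_(0 <= k <oo) leb (K `&` g @^-1` A k))%E).
  rewrite lee_pmul2l//.
  apply: measure_sigma_subadditive.
  - by move=> k; apply: mKg; exact: mA'.
  - exact: mKg.
  by move=> s [Ks /BA[k _ Ak]]; exists k.
rewrite -nneseriesZl//; apply: lee_nneseries => [k _ _|k _].
  by rewrite mule_ge0// lee_fin ltW.
have /ocitvP[->|[[a b] /= ab AE]] := mA k.
  rewrite preimage_set0 setI0 measure0 mule0.
  exact: measure_ge0.
rewrite AE (wlength_itv_bnd _ _ _ (ltW ab))/= -lee_pdivlMl// -EFinM.
apply: lebesgue_measure_le_diam.
- by rewrite -AE; apply: mKg; exact: mA'.
- by rewrite mulr_ge0// ?invr_ge0 ?subr_ge0 ltW.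
move=> s t [Ks /=]; rewrite in_itv/= => /andP[gs1 gs2].
move=> [Kt]; rewrite in_itv/= => /andP[gt1 gt2].
have [st|ts] := leP s t.
- rewrite mulrC ler_pdivlMr// mulrC; apply: (le_trans (Kg _ _ Ks Kt st)).
  by rewrite ler_norml; apply/andP; split; lra.
- have : 0 <= c^-1 * (b - a) by rewrite mulr_ge0// ?invr_ge0 ?subr_ge0 ltW.
  lra.
Qed.

(* The sets are approximated from inside by compact ones, whose images under [g]
   are measurable. *)
Lemma sum_lebesgue_expanding (Z : nat -> set R) (n : nat) (r : R) :
  continuous g -> 0 <= r ->
  (forall j, measurable (Z j)) -> (forall j, leb (Z j) < +oo)%E ->
  (forall j s t, Z j s -> Z j t -> s <= t -> c * (t - s) <= `|g t - g s|) ->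
  (forall i j s t, (i < j)%N -> Z i s -> Z j t -> g s <> g t) ->
  (forall j s, (j < n)%N -> Z j s -> `|g s| <= r) ->
  c * \sum_(j < n) fine (leb (Z j)) <= r *+ 2.
Proof.
move=> cg r0 mZ finZ Zg Zd Zr.
have mg : measurable_fun setT g by exact: continuous_measurable_fun.
apply/ler_addgt0Pr => e e0.
(* The [n] inner approximations lose [c * n * e'] in all, which is at most [e]; [n.+1] keeps the
   denominator nonzero. *)
pose e' := e / (c * n.+1%:R).
have e'0 : 0 < e' by rewrite divr_gt0// mulr_gt0.
have /choice[K HK] j := lebesgue_regularity_inner (mZ j) (finZ j) e'0.
have cK j : compact (K j) by have [] := HK j.
have mK j : measurable (K j) by exact: compact_measurable.
have KZ j : K j `<=` Z j by have [] := HK j.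
have cgK j : compact (g @` K j).
  by apply: continuous_compact => //; exact: continuous_subspaceT.
have mgK j : measurable (g @` K j) by exact: compact_measurable.
have finK j : (leb (K j) < +oo)%E.
  exact: le_lt_trans (le_lebesgue_measure (mK j) (mZ j) (KZ j)) (finZ j).
have fK j : leb (K j) \is a fin_num by rewrite ge0_fin_numE.
have fZ j : leb (Z j) \is a fin_num by rewrite ge0_fin_numE.
have ZK j : fine (leb (Z j)) <= fine (leb (K j)) + e'.
  rewrite -lee_fin EFinD !fineK//.
  have -> : leb (Z j) = (leb (K j) + leb (Z j `\` K j))%E.
    have mZK : measurable (Z j `\` K j : set (measurableTypeR R)).
      by apply: measurableD; [exact: mZ|exact: mK].
    have := measureU lebesgue_measure (mK j) mZK.
    by rewrite setDUK// => -> //; exact: setDIK.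
  by rewrite leeD2l// ltW//; have [] := HK j.
have KgK j : (c%:E * leb (K j) <= leb (g @` K j))%E.
  have := @lebesgue_measure_expanding (K j) (g @` K j) mg (mK j) (mgK j).
  rewrite (_ : K j `&` _ = K j); last first.
    by apply/setIidPl => s Ks; exists s.
  by apply => s t Ks Kt; apply: (Zg j); exact: KZ.
(* The images are pairwise disjoint, since values at distinct indices differ, and they all lie in
   [[- r, r]]. *)
have sumgK : (\sum_(j < n) leb (g @` K j) <= (r *+ 2)%:E)%E.
  have mgKn (i : 'I_n) : measurable (g @` K i : set (measurableTypeR R)).
    exact: mgK.
  rewrite -(measure_bigsetU_ord lebesgue_measure xpredT mgKn); last first.
    apply/trivIsetP => i j _ _; wlog ij : i j / (i < j)%N.
      move=> W; rewrite neq_lt => /orP[ij|ji]; [|rewrite setIC];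
        by apply: W; rewrite // neq_lt ?ij ?ji ?orbT.
    move=> _; apply/seteqP; split => y //= [[s Ks <-] [t Kt]] /esym.
    exact: Zd ij (KZ _ _ Ks) (KZ _ _ Kt).
  apply: (@le_trans _ _ (leb `[- r, r])).
    apply: le_lebesgue_measure => //; first exact: bigsetU_measurable.
    elim/big_ind : _ => [//|A B Ar Br|j _]; first by rewrite subUset.
    move=> _ [s Ks <-] /=.
    by rewrite in_itv/= -ler_norml; exact: Zr (ltn_ord j) (KZ _ _ Ks).
  rewrite lebesgue_measure_itv/= lte_fin; case: ifPn => _.
    by rewrite -EFinD lee_fin; lra.
  by rewrite lee_fin; lra.
apply: (@le_trans _ _ (c * \sum_(j < n) (fine (leb (K j)) + e'))).
  by rewrite ler_pM2l//; apply: ler_sum => j _; exact: ZK.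
rewrite big_split/= mulrDr lerD//.
  rewrite -lee_fin; apply: le_trans sumgK.
  rewrite mulr_sumr -sumEFin; apply: lee_sum => j _.
  by rewrite EFinM fineK.
have n0 : n.+1%:R != 0 :> R by [].
rewrite sumr_const card_ord; have -> : c * (e' *+ n) = e * (n%:R / n.+1%:R).
  rewrite -(mulr_natr e') /e'; move: n.+1%:R n0 => m m0.
  by field; rewrite m0 gt_eqF.
rewrite ger_pMr// ler_pdivrMr// mul1r ler_nat; exact: leqnSn.
Qed.

End expanding.

(** Near [t] the difference quotient exceeds [|l| / 2] in absolute value. A single [n] gives both
    slope and radius once its inverse is below [|l| / 2] and below the radius [e] of that
    neighbourhood. *)
Lemma expanding_of_derivative {R : realType} (g : R -> R) (t l : R) :
  derivable g t 1 -> g^`()%classic t = l -> l != 0 ->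
  exists n : nat, forall s, 0 <= s < n.+1%:R^-1 ->
    n.+1%:R^-1 * s <= `|g (t + s) - g t|.
Proof.
move=> dg; rewrite derive1E => gl l0.
have cvg_l : h^-1 *: (g (h *: 1 + t) - g t) @[h --> 0^'] --> l.
  by rewrite -gl; exact: dg.
have l2 : 0 < `|l| / 2 by rewrite divr_gt0 ?normr_gt0.
have /nbhs_ballP[e /= e0 He] : nbhs (0 : R) (fun h => h != 0 ->
    `|l - h^-1 *: (g (h *: 1 + t) - g t)| < `|l| / 2).
  exact: (@cvgr_dist_lt _ _ _ _ _ _ _ cvg_l _ l2).
pose n := Num.bound (Num.min e (`|l| / 2))^-1.
have m0 : 0 < Num.min e (`|l| / 2) by rewrite lt_min e0.
have := invr_bound_lt m0; rewrite -/n lt_min => /andP[ne nl].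
exists n => s /andP[s0 sn].
have [->|sn0] := eqVneq s 0; first by rewrite mulr0.
have {s0 sn0} s0 : 0 < s by rewrite lt_neqAle eq_sym sn0.
have sball : ball (0 : R) e s.
  by rewrite /ball/= sub0r normrN gtr0_norm// (lt_trans sn).
have := He _ sball (lt0r_neq0 s0).
rewrite [_ *: 1]mulr1 [_ *: (_ - _)]mulrC [s + t]addrC => Hs.
have : `|l| / 2 < `|(g (t + s) - g t) / s|.
  have := ler_normD (l - (g (t + s) - g t) / s) ((g (t + s) - g t) / s).
  by rewrite subrK; move: Hs; clear; lra.
rewrite normrM normfV (gtr0_norm s0) ltr_pdivlMr// => H.
by apply: le_trans (ltW H); rewrite ler_wpM2r// ltW.
Qed.

(** * Almost every point with a nonzero value of [f] is expanding *)

Section expanding_points.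
Context {d : measure_display} {R : realType} {X : measurableMetricType d R}.
Variables (mu : probability X R) (T : R -> X -> X) (f : X -> R).
Hypothesis Tflow : preserving_flow mu T.
Hypothesis mf : measurable_fun setT f.
Local Notation sg := (cocycle T f).

(** The set G_c. One constant serves as slope and as range of times, so that a sequence of values of
    [c] is enough. *)
Definition expanding_point (c : R) : set X := [set x | regular_orbit T f x /\
  forall s, 0 <= s < c -> c * s <= `|sg s x|].

Lemma measurable_expanding_point c : measurable (expanding_point c).
Proof.
pose E (q : rat) := [set x | `|sg (ratr q) x| < c * ratr q].
pose I : set rat := [set q | 0 <= (ratr q : R) < c].
(* By continuity, a violation at a real time persists at a slightly later rational time. *)
have -> : expanding_point c = regular_orbit T f `\` \bigcup_(q in I) E q.
  apply/seteqP; split => x [rx Hx]; split=> //.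
    by move=> [q /= Iq]; rewrite /E/= ltNge Hx.
  move=> s /andP[s0 sc]; rewrite leNgt; apply/negP => cs; apply: Hx.
  have cts : {for s, continuous (fun u => c * u - `|sg u x|)}.
    apply: cvgB; first exact: cvgM (cvg_cst _) cvg_id.
    by apply: cvg_norm; exact: continuous_cocycle.
  have cs0 : 0 < c * s - `|sg s x| by rewrite subr_gt0.
  have /nbhs_ballP[e /= e0 He] := cts _ (lt_nbhsr cs0).
  have [q] := @rat_in_itvoo R s (Num.min c (s + e))
    ltac:(by rewrite lt_min sc ltrDl).
  rewrite in_itv/= lt_min => /and3P[sq qc qe].
  exists q; first by rewrite /I/= qc andbT; lra.
  rewrite /E/= -subr_gt0; apply: He; rewrite /ball/= ltr_norml; lra.
apply: measurableD; first exact: (measurable_regular Tflow).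
rewrite bigcup_mkcond; apply: bigcupT_measurable_rat => q.
case: ifP => // _.
rewrite -[X in measurable X]setTI; apply: measurable_fun_ltr => //.
by apply: measurableT_comp => //; exact: (measurable_cocycle Tflow).
Qed.

Lemma cocycle_expanding c x s t : regular_orbit T f x -> 0 <= s -> s <= t ->
  t - s < c -> expanding_point c (T s x) ->
  c * (t - s) <= `|sg t x - sg s x|.
Proof.
move=> rx s0 st tsc [_ /(_ (t - s))]; rewrite subr_ge0 st tsc => /(_ isT).
have := @cocycleD _ _ _ _ _ _ Tflow mf x (t - s) s rx ltac:(lra) s0.
by rewrite subrK => ->; rewrite addrAC subrr add0r.
Qed.

(** The exceptional set: it is null because a regular orbit spends almost no time in it. *)
Let W := [set x | regular_orbit T f x /\ f x != 0] `\`
  \bigcup_(n : nat) expanding_point n.+1%:R^-1.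

Let measurable_W : measurable W.
Proof.
apply: measurableD; last first.
  by apply: bigcupT_measurable => n; exact: measurable_expanding_point.
apply: measurableI; first exact: (measurable_regular Tflow).
rewrite (_ : (fun x => _) = f @^-1` (~` [set 0])); last first.
  by apply/seteqP; split => x /= /eqP.
rewrite -[X in measurable X]setTI; apply: mf => //.
by apply: measurableC; exact: measurable_set1.
Qed.

Lemma locally_integrable_orbit x : regular_orbit T f x ->
  locally_integrable setT (fun s => f (T s x)).
Proof.
move=> rx; split => //; first exact: (measurable_orbit_fun Tflow).
  exact: openT.
move=> K _ cK; have [M [_ HM]] := compact_bounded cK.
have /integrableP[_] := regular_integrable (- (`|M| + 1)) (`|M| + 1) rx.
apply: le_lt_trans; apply: ge0_subset_integral => //.
- exact: compact_measurable.
- apply/measurable_EFinP; apply: measurable_funTS.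
  apply: measurableT_comp => //.
  exact: (measurable_orbit_fun Tflow).
- move=> s Ks; rewrite /= in_itv/= -ler_norml.
  by apply: HM => //; have := ler_norm M; lra.
Qed.

(** By Lebesgue differentiation, at almost every time [t] the cocycle has derivative [f (T t x)];
    where this is nonzero, [T t x] is an expanding point. *)
Let orbit_W0 x : regular_orbit T f x ->
  (\int[leb]_(s in `[0%R, 1%R]) (\1_W (T s x))%:E = 0)%E.
Proof.
move=> rx.
have mWx (D : set R) : measurable_fun D (fun s => (\1_W (T s x))%:E : \bar R).
  apply/measurable_EFinP; apply: measurable_funTS.
  exact: (measurableT_comp (measurable_indic measurable_W)
    (measurable_orbit Tflow x)).
(* The endpoint 0 is dropped, differentiation being available at positive times only. *)
rewrite -integral_itv_obnd_cbnd//.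
rewrite -[RHS](integral0 leb `]0%R, 1%R]%classic).
apply: ae_eq_integral => //; first exact: mWx.
have := @FTC1 R (fun s => f (T s x)) (BLeft 0)
  (fun y => regular_integrable 0 y rx) (locally_integrable_orbit rx).
move=> /=; apply: filterS; first exact: (ae_filter_ringOfSetsType leb).
move=> t Ht /=.
rewrite in_itv/= => /andP[t0 _]; have [dF F'] := Ht ltac:(by rewrite lte_fin).
rewrite indicE memNset// => -[[rt ft] Wt]; apply: Wt.
have [n Hn] := expanding_of_derivative dF F' ft.
exists n => //; split=> // s /andP[s0 sn]; have {}t0 := ltW t0.
have := Hn s; rewrite s0 sn => /(_ isT).
have -> // : sg s (T t x) = sg (t + s) x - sg t x.
by rewrite [t + s]addrC (cocycleD Tflow mf)// addrAC subrr add0r.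
Qed.

(** By Tonelli and invariance, [mu W] is the mean time spent in [W] during [[0, 1]]. *)
Lemma ae_expanding_point : mu.-integrable setT (EFin \o f) ->
  {ae mu, forall x, f x <> 0 -> exists n : nat, expanding_point n.+1%:R^-1 x}.
Proof.
move=> intf.
have W0 : mu W = 0%E.
  have mEW : measurable_fun setT (fun x => (\1_W x)%:E : \bar R).
    by apply/measurable_EFinP; exact: (measurable_indic measurable_W).
  have := integral_orbit_integral Tflow (D := `[0, 1]) (measurable_itv _) mEW
    (fun x => lee0n _).
  rewrite integral_indic// setIT lebesgue_measure_itv/= lte_fin ltr01.
  rewrite oppr0 adde0 mul1e => <-.
  rewrite -[RHS](integral0 mu setT); apply: ae_eq_integral => //.
    exact: (measurable_orbit_integral Tflow (D := `[0, 1]) (measurable_itv _)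
      mEW (fun x => lee0n _)).
  apply: filterS (ae_regular Tflow mf intf) => x rx _; exact: orbit_W0.
have nW : {ae mu, forall x, ~ W x}.
  by exists W; split => // x /=; exact: contrapT.
apply: filterS2 nW (ae_regular Tflow mf intf) => x nWx rx /eqP fx.
apply: contrapT => H; apply: nWx; split => // -[n _ xn].
by apply: H; exists n.
Qed.

End expanding_points.

(** * Sets without returns are null *)

Section no_return.
Context {d : measure_display} {R : realType} {X : measurableMetricType d R}.
Variables (mu : probability X R) (T : R -> X -> X) (f : X -> R).
Hypothesis Tflow : preserving_flow mu T.
Hypothesis erg : ergodic_flow mu T.
Hypothesis intf : mu.-integrable setT (EFin \o f).
Hypothesis intf0 : \int[mu]_x f x = 0.
Local Notation sg := (cocycle T f).
Let mf : measurable_fun setT f := integrable_EFin_measurable intf.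

Variables (c N : R) (A : set X).
Hypothesis c0 : 0 < c.
Hypothesis mA : measurable A.
Hypothesis A_expanding : A `<=` expanding_point T f c.
Hypothesis A_no_return :
  forall x t, A x -> N < t -> A (T t x) -> sg t x <> 0.

Variables (h : R) (m : nat).
Hypothesis h0 : 0 < h.
Hypothesis hc : h < c.
Hypothesis m0 : (0 < m)%N.
Hypothesis mNh : `|N| + h < m%:R.

(** As [h < c], two visits in one window are close enough for expansion; as [m] exceeds [|N| + h],
    visits in distinct windows are more than [N] apart. *)
Let I j : interval R := `[(j * m)%:R, (j * m)%:R + h].
Let Z x j : set R := [set` I j] `&` [set s | A (T s x)].

Let mZ x j : measurable (Z x j).
Proof.
apply: measurableI => //; rewrite -[X in measurable X]setTI.
exact: (measurable_orbit Tflow x).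
Qed.

Let Zfin x j : (leb (Z x j) <= h%:E)%E.
Proof.
apply: (le_trans (le_lebesgue_measure (mZ x j) (measurable_itv (I j))
  (@subIsetl _ _ _))).
rewrite lebesgue_measure_itv/= lte_fin ltrDl h0 -EFinD lee_fin.
by rewrite addrAC subrr add0r.
Qed.

Let Z_ge0 x j s : Z x j s -> 0 <= s.
Proof.
by move=> [/=]; rewrite in_itv/= => /andP[+ _] _; apply: le_trans.
Qed.

Let sum_visits_le x a C n : regular_orbit T f x -> 0 < a -> 0 <= C ->
  (forall t, 0 <= t -> `|sg t x| <= a * t + C) ->
  c * \sum_(j < n) fine (leb (Z x j)) <= (a * (n * m)%:R + C) *+ 2.
Proof.
move=> rx a0 C0 drift.
apply: (sum_lebesgue_expanding (g := sg ^~ x)) => //.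
- exact: continuous_cocycle.
- by rewrite addr_ge0// mulr_ge0// ltW.
- by move=> j; apply: le_lt_trans (Zfin x j) (ltry _).
- move=> j s t Zs [tI _] st; have s0 := Z_ge0 Zs; have [sI As] := Zs.
  apply: (cocycle_expanding Tflow mf) => //; last exact: A_expanding.
  move: sI tI; rewrite /= !in_itv/= => /andP[s1 _] /andP[_ t2].
  by move: s1 t2 hc; lra.
(* Equal values at [s] and [t] would make the cocycle of [T s x] vanish at its return to [A] after
   time [t - s > N]. *)
- move=> i j s t ij Zs [tI At] E; have s0 := Z_ge0 Zs; have [sI As] := Zs.
  have tsN : `|N| < t - s.
    move: sI tI; rewrite /= !in_itv/= => /andP[_ s2] /andP[t1 _].
    have : (i * m)%:R + m%:R <= (j * m)%:R :> R.
      by rewrite -natrD ler_nat -mulSnr leq_mul2r ij orbT.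
    by move: mNh s2 t1; lra.
  have ts0 : 0 <= t - s by apply: le_trans (ltW tsN).
  have {}tsN : N < t - s by apply: le_lt_trans tsN; exact: ler_norm.
  have := A_no_return As tsN; rewrite -(flowD Tflow) subrK => /(_ At); apply.
  have := @cocycleD _ _ _ _ _ _ Tflow mf x (t - s) s rx ts0 s0.
  by rewrite subrK -E; lra.
(* A window of index [j < n] ends before [j.+1 * m], hence before [n * m]. *)
- move=> j s jn Zs; have s0 := Z_ge0 Zs; apply: (le_trans (drift s s0)).
  rewrite lerD2r ler_pM2l//.
  move: Zs => [/=]; rewrite in_itv/= => /andP[_ s2] _.
  apply: (le_trans s2); apply: (@le_trans _ _ ((j * m)%:R + m%:R)).
    by rewrite lerD2l; have := normr_ge0 N; move: mNh; lra.
  by rewrite -natrD ler_nat -mulSnr leq_mul2r jn orbT.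
Qed.

Let P j x := (\int[leb]_(s in [set` I j]) (\1_A (T s x))%:E)%E.

Let PE j x : P j x = (fine (leb (Z x j)))%:E.
Proof.
rewrite fineK; last first.
  by rewrite ge0_fin_numE//; apply: le_lt_trans (Zfin x j) (ltry _).
rewrite /P -[RHS](_ : leb ([set s | A (T s x)] `&` [set` I j]) = _); last first.
  by rewrite /Z setIC.
rewrite -integral_indic//.
by rewrite -[X in measurable X]setTI; exact: (measurable_orbit Tflow x).
Qed.

Let mEA : measurable_fun setT (fun x => (\1_A x)%:E : \bar R).
Proof. by apply/measurable_EFinP; exact: (measurable_indic mA). Qed.

Let mP j : measurable_fun setT (P j).
Proof.
exact: (measurable_orbit_integral Tflow (measurable_itv _) mEA
  (fun x => lee0n _)).
Qed.

Let intP j : (\int[mu]_x P j x = h%:E * mu A)%E.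
Proof.
rewrite (integral_orbit_integral Tflow _ mEA)//.
rewrite integral_indic// setIT lebesgue_measure_itv/= lte_fin ltrDl h0 -EFinD.
by rewrite addrAC subrr add0r.
Qed.

Let G n x := ((n.+1%:R^-1)%:E * \sum_(j < n.+1) P j x)%E.

Let GE n x : G n x = (n.+1%:R^-1 * \sum_(j < n.+1) fine (leb (Z x j)))%:E.
Proof. by rewrite /G EFinM -sumEFin; under eq_bigr do rewrite PE. Qed.

Let cvg_G x : regular_orbit T f x -> (forall a, 0 < a ->
    exists C, forall t, 0 <= t -> `|sg t x| <= a * t + C) ->
  G n x @[n --> \oo] --> 0%E.
Proof.
move=> rx drift.
rewrite (_ : (fun n => G n x) = EFin \o (fun n =>
  n.+1%:R^-1 * \sum_(j < n.+1) fine (leb (Z x j)))); last first.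
  by apply/funext => n; rewrite GE.
apply: cvg_EFin; first by apply: nearW.
apply/cvgrPdist_le => e e0.
(* With this slope the doubled linear term is half of [e * c * n.+1]; the bound [nC] below makes the
   doubled constant fit into the other half. *)
pose a := e * c / (4 * m%:R).
have a0 : 0 < a by rewrite divr_gt0// mulr_gt0// ltr0n.
have [C HC] := drift a a0.
have {}HC t : 0 <= t -> `|sg t x| <= a * t + `|C|.
  by move=> t0; apply: (le_trans (HC t t0)); rewrite lerD2l ler_norm.
near=> n.
rewrite sub0r normrN ger0_norm/=; last first.
  by rewrite mulr_ge0// sumr_ge0// => j _; exact: fine_ge0.
have := sum_visits_le n.+1 rx a0 (normr_ge0 C) HC.
rewrite ler_pdivrMl//; set S := \sum_(j < n.+1) _ => HS.
have nC : `|C| * 4 / (e * c) <= n.+1%:R.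
  near: n; exists (Num.bound (`|C| * 4 / (e * c))) => // n /= Bn.
  by rewrite ltW// ltr_bound_nat// leqW.
rewrite ler_pdivrMr ?mulr_gt0// in nC.
rewrite -(ler_pM2l c0); apply: (le_trans HS).
rewrite natrM mulrnDl.
have -> : a * (n.+1%:R * m%:R) *+ 2 = (e * c) * n.+1%:R / 2.
  rewrite /a; have : m%:R != 0 :> R by rewrite pnatr_eq0 -lt0n.
  move: m%:R n.+1%:R => M k M0; by field.
lra.
Unshelve. all: by end_near. Qed.

(** The averages [G n] are bounded by [h] and tend to 0 almost everywhere, while each has integral
    [h * mu A] by invariance; dominated convergence makes this product 0. *)
Lemma no_return_null_spaced : mu A = 0%E.
Proof.
have cvgG : {ae mu, forall x, [set: X] x -> G n x @[n --> \oo] --> cst 0%E x}.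
  apply: filterS2 (ae_regular Tflow mf intf)
    (cocycle_drift Tflow intf erg intf0).
  by move=> x rx dx _; exact: cvg_G.
have mG n : measurable_fun setT (G n).
  apply: emeasurable_funM => //; apply: emeasurable_sum => j; exact: mP.
have domG : {ae mu, forall x n, [set: X] x -> (`|G n x| <= cst h%:E x)%E}.
  apply: aeW => x n _; rewrite GE/= lee_fin ger0_norm; last first.
    by rewrite mulr_ge0// sumr_ge0// => j _; exact: fine_ge0.
  rewrite ler_pdivrMl// mulr_natl -[n.+1 in leRHS]card_ord -sumr_const.
  apply: ler_sum => j _; rewrite -lee_fin fineK// ge0_fin_numE//.
  exact: le_lt_trans (Zfin x j) (ltry _).
have [_ _] := dominated_convergence measurableT mG (measurable_cst 0%E) cvgG
  (finite_measure_integrable_cst mu h measurableT) domG.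
rewrite integral_cst// mul0e.
have intG n : (\int[mu]_x G n x = h%:E * mu A)%E.
  rewrite ge0_integralZl//; last 2 first.
  - by apply: emeasurable_sum => j; exact: mP.
  - by move=> x _; apply: sume_ge0 => j _; rewrite PE lee_fin fine_ge0.
  rewrite ge0_integral_sum//; last by move=> j x _; rewrite PE lee_fin fine_ge0.
  under eq_bigr do rewrite intP.
  rewrite -(@fineK _ (mu A)) ?fin_num_measure// -EFinM sumEFin -EFinM.
  by rewrite sumr_const card_ord -[X in _ * X]mulr_natl mulKf.
under eq_fun do rewrite intG.
move=> /(cvg_unique (@ereal_hausdorff R) (cvg_cst _)) /eqP.
by rewrite mule_eq0 eqe gt_eqF//= => /eqP.
Qed.

End no_return.

Lemma no_return_null {d : measure_display} {R : realType}
    {X : measurableMetricType d R} (mu : probability X R) (T : R -> X -> X)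
    (f : X -> R) (c N : R) (A : set X) :
  preserving_flow mu T -> ergodic_flow mu T ->
  mu.-integrable setT (EFin \o f) -> \int[mu]_x f x = 0 ->
  0 < c -> measurable A -> A `<=` expanding_point T f c ->
  (forall x t, A x -> N < t -> A (T t x) -> cocycle T f t x <> 0) ->
  mu A = 0%E.
Proof.
move=> Tflow erg intf intf0 c0 mA Ac AN.
apply: (no_return_null_spaced Tflow erg intf intf0 c0 mA Ac AN (h := c / 2)
  (m := (Num.bound (`|N| + c / 2)).+1)) => //.
- by rewrite divr_gt0.
- by rewrite ltr_pdivrMr// ltr_pMr// ltr1n.
- exact: ltr_bound_nat.
Qed.

(* A zero [t] of the cocycle of [x] with [T t x] expanding is isolated from the
   right, so it is the last zero before some rational.  Last zeros depend
   measurably on [x], which makes the set of returning points measurable without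
   a measurable projection theorem. *)
Section last_zero.
Context {R : realType}.
Variable g : R -> R.
Hypothesis cg : continuous g.
Hypothesis g0 : g 0 = 0.

Definition last_zero (q : R) : R := sup [set t | 0 <= t <= q /\ g t = 0].

Let zeros_has_sup q : 0 <= q -> has_sup [set t | 0 <= t <= q /\ g t = 0].
Proof.
move=> q0; split; first by exists 0; rewrite /= lexx q0.
by exists q => t [/andP[]].
Qed.

Lemma last_zero_ge q t : 0 <= t <= q -> g t = 0 -> t <= last_zero q.
Proof.
move=> /[dup] tq /andP[t0 t1] gt; apply: ub_le_sup => //.
by have [] := zeros_has_sup (le_trans t0 t1).
Qed.

Lemma last_zero_itv q : 0 <= q -> 0 <= last_zero q <= q.
Proof.
move=> q0; rewrite last_zero_ge ?lexx ?q0//=.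
by apply: sup_le_ub => [|t [/andP[]]]; have [] := zeros_has_sup q0.
Qed.

(** Were [g] nonzero at the supremum, it would be nonzero nearby, where there are zeros. *)
Lemma last_zeroP q : 0 <= q -> g (last_zero q) = 0.
Proof.
move=> q0; apply/eqP; apply: contraT => gl.
have ng : 0 < `|g (last_zero q)| by rewrite normr_gt0.
have cn : {for last_zero q, continuous (fun t => `|g t|)}.
  by apply: cvg_norm; exact: cg.
have /nbhs_ballP[e /= e0 He] := cn _ (lt_nbhsr ng).
have [t [tq gt] te] := sup_adherent e0 (zeros_has_sup q0).
have := He t; rewrite /= gt normr0 ltxx; apply.
rewrite /ball/= ger0_norm; first by rewrite -/(last_zero q) in te; lra.
by have := last_zero_ge tq gt; lra.
Qed.

(** By compactness, a continuous function without zeros on [[r, q]] is bounded away from 0, and such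
    a bound can be tested at the rationals strictly inside. This turns the condition into a
    countable one. *)
Lemma no_zeroP r q : r < q ->
  (forall t, r <= t <= q -> g t <> 0) <->
  (exists n : nat, forall k : rat, r < ratr k < q ->
    n.+1%:R^-1 <= `|g (ratr k)|).
Proof.
move=> rq; split=> [Hg|[n Hn] t /andP[rt tq] gt].
- have cn : {within `[r, q], continuous (fun t => `|g t|)}.
    by apply: continuous_subspaceT => t; apply: cvg_norm; exact: cg.
  have [t trq Ht] := EVT_min (ltW rq) cn.
  have gt : 0 < `|g t|.
    by rewrite normr_gt0; apply/eqP/Hg; rewrite in_itv/= in trq.
  exists (Num.bound `|g t|^-1) => k /andP[rk kq].
  apply: (@le_trans _ _ `|g t|); last by apply: Ht; rewrite in_itv/= !ltW.
  by rewrite ltW// invr_bound_lt.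
- have n0 : `|g t| < n.+1%:R^-1 by rewrite gt normr0.
  have cn : {for t, continuous (fun u => `|g u|)} by apply: cvg_norm; exact: cg.
  have /nbhs_ballP[e /= e0 He] := cn _ (lt_nbhsl n0).
  have [k] := @rat_in_itvoo R (Num.max r (t - e)) (Num.min q (t + e)) ltac:(
    rewrite lt_min !gt_max rq /=; apply/and3P; split; lra).
  rewrite in_itv/= gt_max lt_min => /andP[/andP[rk ek] /andP[kq ke]].
  have := Hn k; rewrite rk kq => /(_ isT); apply/negP; rewrite -ltNge.
  by apply: He; rewrite /ball/= ltr_norml; apply/andP; split; lra.
Qed.

End last_zero.

(** * Almost every point of a set of expanding points returns *)

Section returns.
Context {d : measure_display} {R : realType} {X : measurableMetricType d R}.
Variables (mu : probability X R) (T : R -> X -> X) (f : X -> R).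
Hypothesis Tflow : preserving_flow mu T.
Hypothesis mf : measurable_fun setT f.
Local Notation sg := (cocycle T f).
Local Notation regular := (regular_orbit T f).
Let lz q x := last_zero (sg ^~ x) q.

Let lz_itv x q : 0 <= q -> 0 <= lz q x <= q.
Proof. exact: (last_zero_itv (g := sg ^~ x) (cocycle0 T f x)). Qed.

Let lz_ge x q t : 0 <= t <= q -> sg t x = 0 -> t <= lz q x.
Proof. exact: (last_zero_ge (g := sg ^~ x) (cocycle0 T f x)). Qed.

Let lzP x q : regular x -> 0 <= q -> sg (lz q x) x = 0.
Proof.
by move=> rx; apply: (last_zeroP (g := sg ^~ x) (continuous_cocycle rx)
  (cocycle0 T f x)).
Qed.

Let measurable_sg_rel (t : R) (B : set R) : measurable B ->
  measurable [set x | B (sg t x)].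
Proof.
move=> mB; rewrite -[X in measurable X]setTI.
exact: (measurable_cocycle Tflow mf).
Qed.

Let measurable_no_zero r q : 0 <= r <= q ->
  measurable (regular `&` [set x | forall t, r <= t <= q -> sg t x <> 0]).
Proof.
move=> /andP[r0]; rewrite le_eqVlt => /predU1P[<-|rq].
  (* For [r = q] no rational lies strictly between, but the condition concerns a single value. *)
  apply: measurableI; first exact: (measurable_regular Tflow mf).
  rewrite (_ : mkset _ = [set x | (~` [set 0]) (sg r x)]).
    by apply: measurable_sg_rel; apply: measurableC; exact: measurable_set1.
  apply/seteqP; split => x /= Hx.
    by apply: Hx; rewrite lexx.
  by move=> t; rewrite -eq_le => /eqP <-.
rewrite (_ : _ `&` _ = regular `&` \bigcup_(n : nat) ~` \bigcup_(k : rat)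
  [set x | r < ratr k < q /\ `|sg (ratr k) x| < n.+1%:R^-1]).
  apply: measurableI; first exact: (measurable_regular Tflow mf).
  apply: bigcupT_measurable => n; apply: measurableC.
  apply: bigcupT_measurable_rat => k.
  have [rkq|rkq] := boolP (r < ratr k < q); last first.
    by rewrite (_ : mkset _ = set0)//; apply/seteqP; split => x //= [].
  rewrite (_ : mkset _ =
    [set x | `]- n.+1%:R^-1, n.+1%:R^-1[%classic (sg (ratr k) x)]).
    exact: measurable_sg_rel.
  by apply/seteqP; split => x /=; rewrite in_itv/= -ltr_norml//; case.
apply/seteqP; split => x [rx Hx]; split=> //.
  have [n Hn] := (no_zeroP (continuous_cocycle rx) rq).1 Hx.
  by exists n => // -[k _ [/Hn]]; rewrite leNgt => /negP.
have [n _ Hn] := Hx; apply/(no_zeroP (continuous_cocycle rx) rq).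
exists n => k rkq; rewrite leNgt; apply/negP => kn.
by apply: Hn; exists k.
Qed.

(** For [0 < r <= q], the last zero up to [q] is at least [r] exactly when [[r, q]] contains a
    zero. *)
Let measurable_last_zero q : 0 <= q -> measurable_fun regular (lz q).
Proof.
move=> q0; apply: (measurability _ (RGenCInfty.measurableE R)) => //=.
move=> _ [_ [r ->] <-].
have mreg := measurable_regular Tflow mf.
have [r0|r0] := leP r 0.
  rewrite (_ : _ `&` _ = regular)//; apply/setIidPl => x rx /=.
  rewrite in_itv/= andbT; apply: (le_trans r0).
  by have /andP[] := lz_itv x q0.
have [rq|qr] := leP r q; last first.
  rewrite (_ : _ `&` _ = set0)//; apply/seteqP; split => x //= [rx].
  rewrite in_itv/= andbT => rl.
  by have /andP[_ /(le_trans rl)] := lz_itv x q0; rewrite leNgt qr.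
rewrite (_ : _ `&` _ = regular `\`
    (regular `&` [set x | forall t, r <= t <= q -> sg t x <> 0])).
  apply: measurableD => //; apply: measurable_no_zero; rewrite rq andbT ltW//.
apply/seteqP; split => x [rx] /=; rewrite in_itv/= andbT.
- move=> rl; split=> // -[_ /(_ (lz q x))]; apply.
    by rewrite rl; have /andP[] := lz_itv x q0.
  exact: (lzP rx q0).
- move=> H; split=> //; rewrite leNgt; apply/negP => lr; apply: H; split => //.
  move=> t /andP[rt tq] st.
  have t0 : 0 <= t <= q by rewrite tq andbT; lra.
  by have := le_trans rt (lz_ge t0 st); rewrite leNgt lr.
Qed.

Hypothesis erg : ergodic_flow mu T.
Hypothesis intf : mu.-integrable setT (EFin \o f).
Hypothesis intf0 : \int[mu]_x f x = 0.

(** The points of [A] whose last zeros before rationals give no return after [N] form a measurable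
    set, to which [no_return_null] applies. *)
Lemma ae_return (c N : R) (A : set X) : 0 < c -> 0 <= N -> measurable A ->
  A `<=` expanding_point T f c ->
  {ae mu, forall x, A x -> exists t, [/\ N < t, sg t x = 0 & A (T t x)]}.
Proof.
move=> c0 N0 mA Ac.
have mreg := measurable_regular Tflow mf.
pose B q := [set x | regular x /\ (N < lz q x /\ A (T (lz q x) x))].
have mB q : 0 <= q -> measurable (B q).
  move=> q0; have ml := measurable_last_zero q0.
  (* Extending by 0 off the regular points gives a function measurable on all of [X], which can be
     composed with the flow. *)
  pose l := lz q \_ regular.
  have ml' : measurable_fun setT l by exact/(measurable_restrictT _ mreg).1.
  have lE x : regular x -> l x = lz q x by move=> rx; rewrite /l patchE mem_set.
  rewrite (_ : B q = regular `&` (l @^-1` `]N, +oo[ `&`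
    (fun x => T (l x) x) @^-1` A)); last first.
    by apply/seteqP; split => x /= [rx]; rewrite in_itv/= andbT lE.
  apply: measurableI => //; apply: measurableI.
    by rewrite -[X in measurable X]setTI; exact: ml'.
  rewrite -[X in measurable X]setTI.
  suff : measurable_fun setT (fun x => T (l x) x) by exact.
  have mp : measurable_fun setT (fun x => (l x, x) : measurableTypeR R * X).
    by apply: measurable_fun_pair.
  exact: (measurableT_comp (flow_measurable Tflow) mp).
pose bad := A `\` \bigcup_(k in [set k : rat | 0 <= (ratr k : R)]) B (ratr k).
have mbad : measurable bad.
  apply: measurableD => //; rewrite bigcup_mkcond.
  apply: bigcupT_measurable_rat => k; case: ifPn => // /set_mem; exact: mB.
have bad0 : mu bad = 0%E.
  apply: (no_return_null Tflow erg intf intf0 c0 mbad (N := N)).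
    by move=> x [/Ac].
  move=> x t [Ax nBx] Nt [At _] st0.
  have [rx _] := Ac _ Ax; have [rt Et] := Ac _ At.
  (* Since [T t x] is expanding, the cocycle has no zero strictly between [t] and [t + c]; so [t] is
     the last zero before any rational [k] chosen there. *)
  have [k] := @rat_in_itvoo R t (t + c) ltac:(by rewrite ltrDl).
  rewrite in_itv/= => /andP[tk kc]; apply: nBx; exists k.
    by rewrite /=; lra.
  have k0 : 0 <= ratr k :> R by lra.
  have lzt : lz (ratr k) x = t.
    have l0 := lzP rx k0.
    have /andP[_ lk] := lz_itv x k0.
    have t0 : 0 <= t <= ratr k by apply/andP; split; lra.
    move: (lz_ge t0 st0) l0 lk; move: (lz _ _) => l tl l0 lk.
    apply/eqP; rewrite eq_le tl andbT leNgt; apply/negP => lt.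
    have := @cocycle_expanding _ _ _ mu _ _ Tflow mf c x t l rx
      ltac:(lra) tl ltac:(lra) (conj rt Et).
    rewrite l0 st0 subrr normr0 leNgt pmulr_rgt0// subr_gt0 lt//.
  by split=> //; rewrite lzt; split.
exists bad; split => // x /= /not_implyP[Ax nret]; split=> //.
move=> [k k0 [rx [Nl Al]]]; apply: nret; exists (lz (ratr k) x); split=> //.
exact: (lzP rx k0).
Qed.

End returns.

(** * Separability *)

Section separability.
Context {d : measure_display} {R : realType} {X : measurableMetricType d R}.
Variable mu : probability X R.

(** As the total mass is 1, fewer than [n.+2] disjoint sets can have measure at least
    [n.+1%:R^-1]. *)
Lemma countable_disjoint_positive (I : choiceType) (D : set I)
    (F : I -> set X) :
  (forall i, measurable (F i)) -> trivIset D F ->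
  (forall i, D i -> (0 < mu (F i))%E) -> countable D.
Proof.
move=> mF tF F0.
have finF i : mu (F i) \is a fin_num by rewrite fin_num_measure.
have -> : D = \bigcup_n [set i | D i /\ n.+1%:R^-1 <= fine (mu (F i))].
  apply/seteqP; split => [i Di|i [n _ []//]].
  have Fi : 0 < fine (mu (F i)) by rewrite -lte_fin fineK// F0.
  exists (Num.bound (fine (mu (F i)))^-1) => //; split => //.
  by rewrite ltW// invr_bound_lt.
apply: bigcup_countable => // n _; apply: finite_set_countable.
apply: contrapT => /(infinite_set_fset n.+2)[B BD nB].
have : (mu (\big[setU/set0]_(i <- finmap.enum_fset B) F i) <= 1)%E.
  by apply: probability_le1; exact: bigsetU_measurable.
rewrite measure_fbigsetU//; last first.
  by apply: sub_trivIset tF => i /BD[].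
rewrite (eq_bigr (fun i => (fine (mu (F i)))%:E)); last first.
  by move=> i _; rewrite fineK.
rewrite sumEFin lee_fin leNgt => /negP; apply.
apply: (@lt_le_trans _ _ (\sum_(i <- finmap.enum_fset B) n.+1%:R^-1)).
  rewrite big_const_seq count_predT iter_addr_0 -[X in _ < X]mulr_natl.
  by rewrite ltr_pdivlMr// mul1r ltr_nat.
by rewrite !big_seq; apply: ler_sum => i /BD[].
Qed.

Lemma ae_forall_countable (I : Type) (D : set I) (P : I -> X -> Prop) :
  countable D -> (forall i, D i -> {ae mu, forall x, P i x}) ->
  {ae mu, forall x, forall i, D i -> P i x}.
Proof.
move=> /countable_injP[g ginj] aeP.
suff : {ae mu, forall x, forall n i, D i -> g i = n -> P i x}.
  by apply: filterS => x Hx i Di; exact: Hx Di erefl.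
apply/ae_foralln => n.
have [[i [Di gi]]|no] := pselect (exists i, D i /\ g i = n).
  apply: filterS (aeP i Di) => x Pi j Dj gj.
  by rewrite (ginj j i) ?inE// gj gi.
by apply: aeW => x i Di gi; exfalso; apply: no; exists i.
Qed.

Lemma mball_open (x : X) (e : R) : open (ball x e).
Proof.
rewrite openE => y; rewrite ballEmdist /= => xy.
apply/nbhs_ballP; exists (e - mdist x y); first by rewrite /= subr_gt0.
move=> z; rewrite ballEmdist /= => yz.
apply: (le_lt_trans (metric_triangle x y z)); lra.
Qed.

Hypothesis borelX : borel_compatible X.
Hypothesis mu_open : open_positive mu.

(** Take the centres of a maximal disjoint family of balls of radius [e]. It is countable because
    each ball has positive measure, and a point at distance at least [e + e] from every centre could
    be added to it. *)
Lemma countable_net (e : R) : 0 < e ->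
  exists2 D : set X, countable D & forall x, exists2 y, D y & mdist y x < e + e.
Proof.
move=> e0; pose B (x : X) := ball x e.
have [D [_ tD maxD]] := ex_maximal_disjoint_subcollection B setT.
exists D.
  apply: (@countable_disjoint_positive _ D B) => // [x|x _].
    by apply: borelX; exact: mball_open.
  apply: mu_open; first exact: mball_open.
  by exists x; exact: ballxx.
move=> x; apply: contrapT => Hx.
have xD : ~ D x.
  by move=> Dx; apply: Hx; exists x => //; rewrite mdistxx addr_gt0.
apply: (maxD (x |` D)) => //.
  split; first by move=> y Dy; right.
  by move=> /(_ x (or_introl erefl)).
have disj y z : D y -> B x z -> B y z -> False.
  move=> Dy; rewrite /B !ballEmdist/= => xz yz.
  apply: Hx; exists y => //; apply: (le_lt_trans (metric_triangle y z x)).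
  by rewrite (metric_sym z x) ltrD.
move=> y1 y2 /= [->|D1] [->|D2] // [z []].
- by move=> xz yz; have := disj _ _ D2 xz yz.
- by move=> yz xz; have := disj _ _ D1 xz yz.
- by move=> z1 z2; apply: tD => //; exists z.
Qed.

End separability.

(** * Construction of the return times *)

Theorem mainTheorem2 (R : realType) (d : measure_display)
    (X : measurableMetricType d R) (mu : probability X R)
    (T : R -> X -> X) (f : X -> R) :
  borel_compatible X ->
  open_positive mu ->
  preserving_flow mu T ->
  ergodic_flow mu T ->
  mu.-integrable setT (fun x => (f x)%:E) ->
  (\int[mu]_x (f x)%:E = 0)%E ->
  {ae mu, forall x, (forall t, orbit_integrable T f t x) /\
                    continuous (fun t => orbit_integral T f t x)} ->
  {ae mu, forall x, f x <> 0 ->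
    exists t_ : nat -> R,
      [/\ t_ @ \oo --> +oo,
          forall k, orbit_integral T f (t_ k) x = 0 &
          (fun k => T (t_ k) x) @ \oo --> x]}.
Proof.
move=> borelX mu_open Tflow erg intf intf0 _.
have mf := integrable_EFin_measurable intf.
have intf0' : \int[mu]_x f x = 0 by rewrite /Rintegral intf0.
have /choice[D HD] : forall n : nat, exists D : set X, countable D /\
    forall x, exists2 y, D y & mdist y x < n.+1%:R^-1 + n.+1%:R^-1.
  move=> n; have n0 : 0 < n.+1%:R^-1 :> R by [].
  by have [D cD HD] := countable_net borelX mu_open n0; exists D.
(* A point and its return to this ball are within [4 / n.+1] of each other; the same [n] also serves
   as the lower bound on the return time. *)
pose A n k y :=
  ball y (n.+1%:R^-1 + n.+1%:R^-1) `&` expanding_point T f k.+1%:R^-1.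
have aeA : {ae mu, forall x n k y, D n y -> A n k y x ->
    exists t, [/\ n%:R < t, cocycle T f t x = 0 & A n k y (T t x)]}.
  apply/ae_foralln => n; apply/ae_foralln => k.
  apply: ae_forall_countable; first by have [] := HD n.
  move=> y _.
  apply: (ae_return Tflow mf erg intf intf0' (c := k.+1%:R^-1)) => //.
    apply: measurableI; first by apply: borelX; exact: mball_open.
    exact: (measurable_expanding_point Tflow mf).
  exact: subIsetr.
apply: filterS2 aeA (ae_expanding_point Tflow mf intf).
move=> x retx expx /expx[k xk].
have /choice[t Ht] : forall n : nat, exists t : R, [/\ n%:R < t,
    cocycle T f t x = 0 & mdist x (T t x) < n.+1%:R^-1 *+ 4].
  move=> n; have [_ /(_ x)[y Dy yx]] := HD n.
  have Ax : A n k y x by split=> //; rewrite ballEmdist.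
  have [t [nt st [yt _]]] := retx n k y Dy Ax; exists t; split => //.
  rewrite ballEmdist /= in yt; apply: (le_lt_trans (metric_triangle x y _)).
  rewrite (metric_sym x y); move: (n.+1%:R^-1) yx yt => e yx yt; lra.
exists t; split.
- apply/cvgryPge => M; near=> n; have [nt _ _] := Ht n.
  apply: (le_trans _ (ltW nt)); near: n; exists (Num.bound M) => // n /= Mn.
  by rewrite ltW// ltr_bound_nat.
(* The return times are positive, so the oriented integral is the cocycle. *)
- move=> n; have [nt st _] := Ht n; rewrite /orbit_integral ifT//.
  by apply: (le_trans _ (ltW nt)).
- apply/metricType_numDomainType.cvgrPdist_lt => e e0; near=> n.
  have [_ _ xn] := Ht n; apply: (lt_le_trans xn).
  rewrite -[_ *+ 4]mulr_natl ler_pdivrMr// mulrC -ler_pdivrMr//.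
  near: n; exists (Num.bound (4 / e)) => // n /= Mn.
  by rewrite ltW// ltr_bound_nat// leqW.
Unshelve. all: by end_near. Qed.
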